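(* Let $R$ be a finite commutative ring with nonzero identity. If $R$ is a weak nil clean ring but not a nil clean ring, then $\operatorname{diam}(G_N(R))=2$, where $G_N(R)$ is the nil clean graph of $R$.
   Context: An element $r$ of a ring $R$ is nil clean if $r=n+e$ for some nilpotent $n\in R$ and some idempotent $e\in R$; the ring $R$ is nil clean if all its elements are nil clean. A ring $R$ is weak nil clean if every $r\in R$ can be written as $r=n+e$ or $r=n-e$ with $n\in R$ nilpotent and $e\in R$ idempotent. The nil clean graph $G_N(R)$ is the simple undirected graph (no loops) with vertex set $R$ in which two distinct vertices $x,y$ are adjacent if and only if $x+y$ is a nil clean element of $R$. The distance $d(x,y)$ is the number of edges on a shortest path between $x$ and $y$ ($\infty$ if there is none), and the diameter is the maximum of $d(x,y)$ over pairs of distinct vertices. *)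

(* Defs.v *)
From HB Require Import structures.
From mathcomp Require Import all_boot all_algebra.
From mathcomp Require Import boolp.

Set Implicit Arguments.
Unset Strict Implicit.
Unset Printing Implicit Defensive.

Import GRing.Theory.
Local Open Scope ring_scope.

Definition nilpotent_elt (R : nzRingType) (x : R) : Prop :=
  exists n : nat, x ^+ n = 0.

Definition idempotent_elt (R : nzRingType) (x : R) : Prop := x * x = x.

Definition nil_clean_elt (R : nzRingType) (r : R) : Prop :=
  exists n e : R, [/\ nilpotent_elt n, idempotent_elt e & r = n + e].

Definition nil_clean_ring (R : nzRingType) : Prop :=
  forall r : R, nil_clean_elt r.

Definition weak_nil_clean_ring (R : nzRingType) : Prop :=
  forall r : R, exists n e : R,
    [/\ nilpotent_elt n, idempotent_elt e & r = n + e \/ r = n - e].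

Definition nil_clean_graph (R : finComNzRingType) : rel R :=
  fun x y => (x != y) && `[< nil_clean_elt (x + y) >].

Lemma nil_clean_graph_sym (R : finComNzRingType) :
  symmetric (@nil_clean_graph R).
Proof. by move=> x y; rewrite /nil_clean_graph eq_sym addrC. Qed.

Lemma nil_clean_graph_irrefl (R : finComNzRingType) :
  irreflexive (@nil_clean_graph R).
Proof. by move=> x; rewrite /nil_clean_graph eqxx. Qed.

Definition has_path_of_length (T : finType) (e : rel T) (x y : T) (n : nat) :
    bool :=
  [exists p : n.-tuple T, [&& path e x p, last x p == y & uniq (x :: p)]].

Lemma connect_has_path (T : finType) (e : rel T) (x y : T) :
  connect e x y -> exists n, has_path_of_length e x y n.
Proof.
case/connectP=> p ep ->; case/shortenP: ep => q eq uq _.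
exists (size q); apply/existsP; exists (in_tuple q).
by rewrite /= eq eqxx /=.
Qed.

(* Distances and diameters live in [option nat], where [None] is infinity. *)
Definition graph_dist (T : finType) (e : rel T) (x y : T) : option nat :=
  match @idP (connect e x y) with
  | ReflectT xy => Some (ex_minn (connect_has_path xy))
  | ReflectF _ => None
  end.

Definition max_dist (a b : option nat) : option nat :=
  match a, b with
  | Some m, Some n => Some (maxn m n)
  | _, _ => None
  end.

(* A graph on at most one vertex gets diameter 0 by convention. *)
Definition graph_diam (T : finType) (e : rel T) : option nat :=
  \big[max_dist/Some 0%N]_(p : T * T | p.1 != p.2) graph_dist e p.1 p.2.

(* Main.v *)
(* Modulo its nilradical, a finite commutative ring that is weak nil clean but
   not nil clean is F_3 x B with B Boolean: there 6 = 0 and every element is an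
   idempotent or minus one.  An element is nil clean iff its F_3-component is 0
   or 1, so adjacency only depends on the F_3-components, which form the looped
   path 0 - 1 - (-1).  The components are handled without quotients: x has
   component 0, 1 or -1 according as 2x, 2x - 2 or 2x + 2 is nilpotent. *)
From HB Require Import structures.
Require Import Defs.
From mathcomp Require Import all_boot all_algebra.
From mathcomp Require Import boolp ring.

Set Implicit Arguments.
Unset Strict Implicit.
Unset Printing Implicit Defensive.

Import GRing.Theory.

(** * Distances under maximum as a commutative monoid *)

Lemma max_distA : associative max_dist.
Proof. by move=> [a|] [b|] [c|] //=; rewrite maxnA. Qed.

Lemma max_distC : commutative max_dist.
Proof. by move=> [a|] [b|] //=; rewrite maxnC. Qed.

Lemma max_dist0 : left_id (Some 0%N) max_dist.
Proof. by case=> [a|] //=; rewrite max0n. Qed.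

HB.instance Definition _ :=
  Monoid.isComLaw.Build _ _ max_dist max_distA max_distC max_dist0.

(* Generalizes [P] away from [b] so that the match in [graph_dist] can be
   eliminated. *)
Lemma match_reflect_ex_minn (P : Prop) b (r : reflect P b) (Q : pred nat)
    (exQ : P -> exists n, Q n) n :
    P -> Q n -> (forall m, Q m -> n <= m) ->
  match r with
  | ReflectT p => Some (ex_minn (exQ p))
  | ReflectF _ => None
  end = Some n.
Proof.
case: r => // p _ Qn n_min; case: ex_minnP => m Qm m_min.
by congr Some; apply/eqP; rewrite eqn_leq m_min // n_min.
Qed.

(** * Short paths, distances and the diameter *)

Section Graph.
Variables (T : finType) (e : rel T).

Lemma has_path_connect x y n : has_path_of_length e x y n -> connect e x y.
Proof.
by case/existsP=> p /and3P[ep /eqP <- _]; apply/connectP; exists p.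
Qed.

Lemma graph_dist_eq x y n :
    has_path_of_length e x y n ->
    (forall m, has_path_of_length e x y m -> n <= m) ->
  graph_dist e x y = Some n.
Proof.
move=> pn n_min; rewrite /graph_dist.
exact: match_reflect_ex_minn (has_path_connect pn) pn n_min.
Qed.

Lemma has_path0 x y : has_path_of_length e x y 0 = (x == y).
Proof.
apply/existsP/idP => [[p]|/eqP ->]; first by rewrite tuple0 /= andbT.
by exists [tuple]; rewrite /= eqxx.
Qed.

Lemma has_path1 x y : has_path_of_length e x y 1 = e x y && (x != y).
Proof.
apply/existsP/idP => [[p]|/andP[exy xy]].
  case/tupleP: p => z p; rewrite (tuple0 p) /= andbT inE.
  by case/and3P=> exz /eqP <-; rewrite exz andbT.
by exists [tuple y]; rewrite /= exy eqxx inE xy.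
Qed.

Lemma has_path2 x z y :
  e x z -> e z y -> uniq [:: x; z; y] -> has_path_of_length e x y 2.
Proof.
by move=> xz zy u; apply/existsP; exists [tuple z; y]; rewrite u /= xz zy eqxx.
Qed.

Lemma graph_dist1 x y : x != y -> e x y -> graph_dist e x y = Some 1.
Proof.
move=> xy exy; apply: graph_dist_eq => [|[|m]//]; first by rewrite has_path1 exy.
by rewrite has_path0 (negPf xy).
Qed.

Lemma graph_dist2 x z y : ~~ e x y -> e x z -> e z y -> uniq [:: x; z; y] ->
  graph_dist e x y = Some 2.
Proof.
move=> nxy xz zy u; apply: graph_dist_eq => [|[|[|m]]//].
- exact: has_path2 xz zy u.
- by rewrite has_path0 => /eqP xy; move: u; rewrite /= xy !inE eqxx orbT.
- by rewrite has_path1 (negPf nxy).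
Qed.

Lemma graph_diam_eq d x0 y0 :
    (forall x y, x != y -> exists2 k, graph_dist e x y = Some k & k <= d) ->
    x0 != y0 -> graph_dist e x0 y0 = Some d ->
  graph_diam e = Some d.
Proof.
(* The pair attaining [d] is split off the maximum. For the rest, the invariant is to be finite and
   at most [d]. *)
move=> dist_le xy0 dxy0; rewrite /graph_diam (bigD1 (x0, y0)) //= dxy0.
set b := \big[_/_]_(_ | _) _.
have [k -> kd] : exists2 k, b = Some k & k <= d.
  apply: (big_ind (fun u => exists2 k, u = Some k & k <= d)).
  - by exists 0.
  - by move=> _ _ [k -> kd] [l -> ld]; exists (maxn k l); rewrite // geq_max kd.
  - by move=> p /andP[p12 _]; apply: dist_le.
by congr Some; apply/maxn_idPl.
Qed.

End Graph.

Local Open Scope ring_scope.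

(** * Nilpotent elements of a commutative ring *)

Section Nilpotent.
Variable R : comNzRingType.
Implicit Types x y : R.

(** If x^m = y^n = 0, each binomial term of (x + y)^(m + n) contains x^m or y^n. *)
Lemma nilpotentD x y :
  nilpotent_elt x -> nilpotent_elt y -> nilpotent_elt (x + y).
Proof.
move=> [m xm] [n yn]; exists (m + n)%N; rewrite exprDn big1 // => i _.
have [ni|/ltnW in_] := leqP n i.
  by rewrite -(subnK ni) exprD yn !mulr0 mul0rn.
by rewrite -addnBA // exprD xm !mul0r mul0rn.
Qed.

Lemma nilpotentMl a x : nilpotent_elt x -> nilpotent_elt (a * x).
Proof. by case=> n xn; exists n; rewrite exprMn xn mulr0. Qed.

Lemma nilpotentN x : nilpotent_elt x -> nilpotent_elt (- x).
Proof. by rewrite -mulN1r; apply: nilpotentMl. Qed.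

Lemma nilpotent0 : nilpotent_elt (0 : R).
Proof. by exists 1%N; rewrite expr1. Qed.

(** If x = n + e, then x is idempotent modulo n, so x^2 - x is a multiple of n. Weak nil cleanness
    gives the converse, [nilpotent_nil_clean]. *)
Lemma nil_clean_nilpotent x : nil_clean_elt x -> nilpotent_elt (x * x - x).
Proof.
case=> n [e [nn ee ->]]; rewrite /idempotent_elt in ee.
have -> : (n + e) * (n + e) - (n + e) = (n + 2 * e - 1) * n + (e * e - e).
  by ring.
by rewrite ee subrr addr0; apply: nilpotentMl.
Qed.

End Nilpotent.

(** * Arithmetic modulo nilpotents in a weak nil clean ring *)

Section WeakNilClean.
Variables (R : comNzRingType).
Hypotheses (hweak : weak_nil_clean_ring R) (hnot : ~ nil_clean_ring R).
Implicit Types x y : R.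

(** If x = n - e, then -x = -n + e is nil clean, and (-x)^2 - (-x) = x^2 + x. *)
Lemma weak_nilpotent x :
  nilpotent_elt (x * x - x) \/ nilpotent_elt (x * x + x).
Proof.
have [n [e [nn ee xE]]] := hweak x; case: xE => xE.
  by left; apply: nil_clean_nilpotent; exists n, e.
right; have -> : x * x + x = (- x) * (- x) - (- x) by ring.
by apply: nil_clean_nilpotent; exists (- n), e; rewrite xE opprB addrC;
  split=> //; apply: nilpotentN.
Qed.

(* Lifting idempotents is not needed: if x = n - e, then 2e is nilpotent. *)
Lemma nilpotent_nil_clean x : nilpotent_elt (x * x - x) -> nil_clean_elt x.
Proof.
move=> nx; have [n [e [nn ee xE]]] := hweak x; case: xE => xE.
  by exists n, e.
exists (n - 2 * e), e; split=> //; last by rewrite xE; ring.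
rewrite /idempotent_elt in ee.
have -> : n - 2 * e = - (x * x - x) + (n - 2 * e) * n + (e * e - e).
  by rewrite xE; ring.
rewrite ee subrr addr0; apply: nilpotentD; first exact: nilpotentN.
exact: nilpotentMl.
Qed.

(** Otherwise x^2 - x and x^2 + x would differ by the nilpotent 2x, making every element nil
    clean. *)
Lemma two_not_nilpotent : ~ nilpotent_elt (2 : R).
Proof.
move=> n2; apply: hnot => x; apply: nilpotent_nil_clean.
have [//|nx] := weak_nilpotent x.
have -> : x * x - x = (x * x + x) + (- x) * 2 by ring.
by apply: nilpotentD => //; apply: nilpotentMl.
Qed.

Lemma six_nilpotent : nilpotent_elt (6 : R).
Proof.
(* At 2 the two alternatives read: 2 is nilpotent, or 6 is. *)
have [n2|n6] := weak_nilpotent 2; last first.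
  by have <- : 2 * 2 + 2 = 6 :> R by ring.
by case: two_not_nilpotent; have <- : 2 * 2 - 2 = 2 :> R by ring.
Qed.

(** Lets the identities below, proved by [ring] over the integers, be used modulo 6. *)
Lemma nilpotent_mul6 a x : nilpotent_elt x -> nilpotent_elt (a * 6 + x).
Proof.
by move=> nx; apply: nilpotentD => //; apply: nilpotentMl; apply: six_nilpotent.
Qed.

Lemma component0_or_1 x : nilpotent_elt (x * x - x) ->
  nilpotent_elt (2 * x) \/ nilpotent_elt (2 * x - 2).
Proof.
(* 4x - 2 squares to 4, so being plus or minus an idempotent it is 4 or -4. *)
move=> nx; have [ny|ny] := weak_nilpotent (4 * x - 2).
  left; have -> : 2 * x = (x - 1) * 6 + ((- 16) * (x * x - x)
    + ((4 * x - 2) * (4 * x - 2) - (4 * x - 2))) by ring.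
  by apply: nilpotent_mul6; apply: nilpotentD => //; apply: nilpotentMl.
right; have -> : 2 * x - 2 = (x - 1) * 6 + (16 * (x * x - x)
    + ((-1) * ((4 * x - 2) * (4 * x - 2) + (4 * x - 2)) + 6)) by ring.
apply: nilpotent_mul6; apply: nilpotentD; first exact: nilpotentMl.
by apply: nilpotentD; [apply: nilpotentMl | apply: six_nilpotent].
Qed.

(** [component0_or_1] applies to x or to -x, and negation swaps the components 1 and -1. *)
Lemma components x : [\/ nilpotent_elt (2 * x), nilpotent_elt (2 * x - 2)
                       | nilpotent_elt (2 * x + 2)].
Proof.
have [/component0_or_1[]|nx] := weak_nilpotent x.
- by constructor 1.
- by constructor 2.
have /component0_or_1[] : nilpotent_elt ((- x) * (- x) - (- x)).
- by have -> : (- x) * (- x) - (- x) = x * x + x by ring.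
- by move/nilpotentN; rewrite mulrN opprK; constructor 1.
- move/nilpotentN; have -> : - (2 * - x - 2) = 2 * x + 2 by ring.
  by constructor 3.
Qed.

(* 3(x^2 - x) is always nilpotent, so only 2(x^2 - x) matters. *)
Lemma nil_clean_component x :
  nilpotent_elt (2 * x) \/ nilpotent_elt (2 * x - 2) -> nil_clean_elt x.
Proof.
move=> x01; apply: nilpotent_nil_clean; have [//|nx] := weak_nilpotent x.
have n2 : nilpotent_elt (2 * (x * x - x)).
  case: x01 => n2x.
    have -> : 2 * (x * x - x) = (x - 1) * (2 * x) by ring.
    exact: nilpotentMl.
  have -> : 2 * (x * x - x) = x * (2 * x - 2) by ring.
  exact: nilpotentMl.
have -> : x * x - x = (- x) * 6 + (3 * (x * x + x) + (-1) * (2 * (x * x - x))).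
  by ring.
by apply: nilpotent_mul6; apply: nilpotentD; apply: nilpotentMl.
Qed.

Lemma opp1_not_nil_clean : ~ nil_clean_elt (-1 : R).
Proof.
move/nil_clean_nilpotent; have -> : (-1) * (-1) - (-1) = 2 :> R by ring.
exact: two_not_nilpotent.
Qed.

(** This and the next two lemmas keep the common neighbours 0 and 1 distinct from the endpoints, as
    the graph has no loops. *)
Lemma component0_neq1 x : nilpotent_elt (2 * x) -> x != 1.
Proof.
by move=> nx; apply/eqP=> x1; case: two_not_nilpotent; rewrite x1 mulr1 in nx.
Qed.

Lemma component1_neq0 x : nilpotent_elt (2 * x - 2) -> x != 0.
Proof.
move=> /nilpotentN nx; apply/eqP=> x0; apply: two_not_nilpotent.
by move: nx; rewrite x0 mulr0 sub0r opprK.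
Qed.

Lemma componentN1_neq1 x : nilpotent_elt (2 * x + 2) -> x != 1.
Proof.
move=> nx; apply/eqP=> x1; apply: two_not_nilpotent.
(* At x = 1 the hypothesis makes 4 nilpotent, and 2 = 6 - 4. *)
have -> : 2 = 1 * 6 + (-1) * (2 * 1 + 2) :> R by ring.
by apply: nilpotent_mul6; apply: nilpotentMl; rewrite x1 in nx.
Qed.

(** Of the nine pairs of components, only 0 with -1 (in either order) and 1 with 1 sum to -1. In the
    first case 1 is a common neighbour, in the second 0. *)
Lemma nil_clean_add_or_common_neighbour x y :
  nil_clean_elt (x + y) \/
  exists z, [/\ nil_clean_elt (x + z), nil_clean_elt (z + y), x != z & z != y].
Proof.
have two_steps (u v : R) : nilpotent_elt (2 * u) -> nilpotent_elt (2 * v + 2) ->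
    [/\ nil_clean_elt (u + 1), nil_clean_elt (v + 1), u != 1 & v != 1].
  move=> nu nv; split; [| |exact: component0_neq1|exact: componentN1_neq1].
    by apply: nil_clean_component; right; have -> : 2 * (u + 1) - 2 = 2 * u by ring.
  by apply: nil_clean_component; left; have -> : 2 * (v + 1) = 2 * v + 2 by ring.
case: (components x) (components y) => nx [] ny.
- left; apply: nil_clean_component; left.
  by rewrite mulrDr; apply: nilpotentD.
- left; apply: nil_clean_component; right.
  by rewrite mulrDr -addrA; apply: nilpotentD.
- right; exists 1; have [? ? ? ?] := two_steps x y nx ny.
  by split; rewrite // 1?addrC // eq_sym.
- left; apply: nil_clean_component; right.
  by rewrite mulrDr addrAC; apply: nilpotentD.
- right; exists 0; rewrite addr0 add0r [0 == y]eq_sym.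
  split; [| |exact: component1_neq0|exact: component1_neq0];
  by apply: nil_clean_component; right.
- left; apply: nil_clean_component; left.
  have -> : 2 * (x + y) = (2 * x - 2) + (2 * y + 2) by ring.
  exact: nilpotentD.
- right; exists 1; have [? ? ? ?] := two_steps y x ny nx.
  by split; rewrite // 1?addrC // eq_sym.
- left; apply: nil_clean_component; left.
  have -> : 2 * (x + y) = (2 * x + 2) + (2 * y - 2) by ring.
  exact: nilpotentD.
- left; apply: nil_clean_component; right.
  (* In F_3, (-1) + (-1) = 1; the correction is a multiple of 6. *)
  have -> : 2 * (x + y) - 2 = (-1) * 6 + ((2 * x + 2) + (2 * y + 2)) by ring.
  by apply: nilpotent_mul6; apply: nilpotentD.
Qed.

End WeakNilClean.

(** * Distances in the nil clean graph *)

Section NilCleanGraph.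
Variable R : finComNzRingType.
Hypotheses (hweak : weak_nil_clean_ring R) (hnot : ~ nil_clean_ring R).
Implicit Types x y : R.

Lemma nil_clean_graph_dist x y : x != y ->
  graph_dist (@nil_clean_graph R) x y =
    Some (if `[< nil_clean_elt (x + y) >] then 1%N else 2%N).
Proof.
move=> xy; case: asboolP => [xyC|nxy].
  by apply: graph_dist1; rewrite // /nil_clean_graph xy; apply/asboolP.
have [//|[z [xz zy nxz nzy]]] :=
  nil_clean_add_or_common_neighbour hweak hnot x y.
apply: (@graph_dist2 _ _ _ z); rewrite /nil_clean_graph ?nxz ?nzy ?xy /=.
- exact/asboolP.
- exact/asboolP.
- exact/asboolP.
- by rewrite !inE negb_or nxz xy nzy.
Qed.

End NilCleanGraph.

Theorem theorem3p11 (R : finComNzRingType)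
    (hweak : weak_nil_clean_ring R) (hnot : ~ nil_clean_ring R) :
  graph_diam (@nil_clean_graph R) = Some 2%N.
Proof.
(* The pair 0, -1 attains distance 2, since its sum -1 is not nil clean. *)
have n0N1 : 0 != -1 :> R by rewrite eq_sym oppr_eq0 oner_neq0.
apply: (graph_diam_eq _ n0N1) => [x y xy|].
  rewrite (nil_clean_graph_dist hweak hnot xy).
  by case: ifP => _; [exists 1%N | exists 2%N].
rewrite (nil_clean_graph_dist hweak hnot n0N1).
by case: asboolP => //; rewrite add0r => /(opp1_not_nil_clean hweak hnot).
Qed.
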